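(* Let $n\ge3$ and $\lceil n/2\rceil\leq S\leq n-1$. For $0\leq j\leq n-S$, the M\''obius function $\mu$ of $J_{3,S}^n$ at any $\pi\in J_{3,S}^n$ with $\operatorname{sh}(\pi)=(2^{n-S-j},1^{2S-n+2j})$ satisfies $\mu(\pi,\hat{\mathbf{1}}_n)=b_{2j}^{2S-n}$.
   Context: $\Pi_n$ denotes the set of all partitions of $\{1,\dots,n\}$ into nonempty disjoint blocks, ordered by refinement: $\pi\le\sigma$ iff every block of $\pi$ is contained in a block of $\sigma$; $|\pi|$ is the number of blocks, and $\hat{\mathbf{1}}_n$ is the one-block partition. The shape $\operatorname{sh}(\pi)$ is the integer partition of $n$ listing the block sizes in decreasing order; $(2^p,1^q)$ denotes the integer partition with $p$ parts equal to $2$ and $q$ parts equal to $1$. For $\lceil n/2\rceil\le S\le n-1$, $$J_{3,S}^n:=\{\pi\in\Pi_n:\ \text{every block of }\pi\text{ has at most 2 elements and }|\pi|\geq S\}\cup\{\hat{\mathbf{1}}_n\},$$ with the order induced from $\Pi_n$. Its M\''obius function is: $\mu(x,x)=1$, $\mu(x,y)=-\sum_{z\in J_{3,S}^n,\,x\le z<y}\mu(x,z)$ for $x<y$, and $\mu(x,y)=0$ otherwise. For $a\in\mathbb{Z}_{\ge0}$, the numbers $b_j^a$ with $j$ even are defined by $b_0^a:=-1$ and, for $j\ge1$, $$b_{2j}^a:=-1-\sum_{l=0}^{j-1}b_{2l}^a\binom{a+2j}{a+2l}\frac{(2j-2l)!}{2^{j-l}(j-l)!}.$$ *)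

(* Defs.v *)
From HB Require Import structures.
From mathcomp Require Import all_boot all_order all_algebra.

Set Implicit Arguments.
Unset Strict Implicit.
Unset Printing Implicit Defensive.

Import Order.TTheory GRing.Theory Num.Theory.

Local Open Scope ring_scope.

(** The lattice of set partitions, with {1, .., n} encoded as 'I_n *)

Record setpart (n : nat) : predArgType := SetPart {
  blocks : {set {set 'I_n}};
  blocksP : partition blocks [set: 'I_n]
}.

HB.instance Definition _ n := [isSub for @blocks n].
HB.instance Definition _ n := [Finite of setpart n by <:].

Definition refines n (p q : setpart n) : bool :=
  [forall B in blocks p, [exists C in blocks q, B \subset C]].

Lemma refinesP n (p q : setpart n) :
  reflect (forall B, B \in blocks p -> exists2 C, C \in blocks q & B \subset C)
          (refines p q).
Proof.
apply: (iffP forall_inP) => H B Bp; first by case/exists_inP: (H B Bp) => C; exists C.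
by have [C Cq BC] := H B Bp; apply/exists_inP; exists C.
Qed.

Lemma refines_refl n : reflexive (@refines n).
Proof. by move=> p; apply/refinesP => B Bp; exists B. Qed.

Lemma refines_trans n : transitive (@refines n).
Proof.
move=> q p r /refinesP pq /refinesP qr; apply/refinesP => B /pq[C /qr[D Dr CD] BC].
by exists D => //; apply: subset_trans CD.
Qed.

Lemma refines_sub n (p q : setpart n) :
  refines p q -> refines q p -> blocks p \subset blocks q.
Proof.
move=> /refinesP pq /refinesP qp; apply/subsetP => B Bp.
have [C Cq BC] := pq B Bp; have [B' B'p CB'] := qp C Cq.
have /and3P[_ /trivIsetP tp p0] := blocksP p.
have [x xB] : exists x, x \in B.
  by apply/set0Pn; apply: contraNneq p0 => <-.
have eBB' : B = B'.
  apply/eqP; apply: contraT => nBB'; have := tp B B' Bp B'p nBB'.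
  by move/disjointFr/(_ xB); rewrite (subsetP CB') ?(subsetP BC).
by have -> : B = C by apply/eqP; rewrite eqEsubset BC eBB' CB'.
Qed.

Lemma refines_anti n : antisymmetric (@refines n).
Proof.
move=> p q /andP[pq qp]; apply: val_inj; apply/eqP.
by rewrite eqEsubset !refines_sub.
Qed.

Fact setpart_display : Order.disp_t. Proof. exact: Order.Disp tt tt. Qed.

HB.instance Definition _ n :=
  Order.Le_isPOrder.Build setpart_display (setpart n)
    (@refines_refl n) (@refines_anti n) (@refines_trans n).

Lemma setpart_leE n (p q : setpart n) : (p <= q)%O = refines p q.
Proof. by []. Qed.

(** Removing [set0] only matters for [n = 0], whose unique partition is empty. *)
Lemma onepart_subproof n : partition ([set [set: 'I_n]] :\ set0) [set: 'I_n].
Proof.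
apply/and3P; split; last by rewrite !inE eqxx.
  rewrite /cover; apply/eqP/setP => x; rewrite inE; apply/bigcupP.
  exists [set: 'I_n]; rewrite !inE // eqxx andbT.
  by apply/set0Pn; exists x; rewrite inE.
by apply/trivIsetP => A B; rewrite !inE => /andP[_ /eqP->] /andP[_ /eqP->]; rewrite eqxx.
Qed.

Definition onepart n : setpart n := SetPart (onepart_subproof n).

Lemma onepartE n : (0 < n)%N -> blocks (onepart n) = [set [set: 'I_n]].
Proof.
move=> n0; apply/setP => B; rewrite !inE andbC; case: eqVneq => //= ->.
by apply/set0Pn; exists (Ordinal n0); rewrite inE.
Qed.

Definition pshape n (p : setpart n) : seq nat :=
  sort geq [seq #|B| | B : {set 'I_n} in blocks p].

(** [J3 n S] is the set underlying $J_{3,S}^n$; its order is that of [setpart n]. *)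
Definition J3 (n S : nat) : {set setpart n} :=
  [set p | [forall B in blocks p, #|B| <= 2]%N && (S <= #|blocks p|)%N]
    :|: [set onepart n].

(** [mobius J] is the Moebius function of [J] with the order induced from [T].
    The argument [k] bounds the recursion depth; [#|T|] steps always suffice, as
    [mobius_lt] shows. *)
Section Mobius.
Variables (d : Order.disp_t) (T : finPOrderType d) (J : {set T}).

Fixpoint mobius_rec (k : nat) (x y : T) : int :=
  if k is k'.+1 then
    if x == y then 1
    else if (x < y)%O then
      - \sum_(z in J | (x <= z)%O && (z < y)%O) mobius_rec k' x z
    else 0
  else 0.

Definition mobius (x y : T) : int := mobius_rec #|T| x y.

Let below (y : T) := #|[set z : T | (z <= y)%O]|.

Let below_lt x y : (x < y)%O -> (below x < below y)%N.
Proof.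
move=> xy; apply: proper_card; apply/properP; split.
  by apply/subsetP => z; rewrite !inE => zx; apply: le_trans zx (ltW xy).
by exists y; rewrite !inE // ?lt_geF.
Qed.

Let mobius_rec_stable k k' x y : (below y <= k)%N -> (below y <= k')%N ->
  mobius_rec k x y = mobius_rec k' x y.
Proof.
have below_gt0 z : (0 < below z)%N by apply/card_gt0P; exists z; rewrite inE.
elim: k k' y => [|k IHk] [|k'] y; rewrite ?leqn0 ?(gtn_eqF (below_gt0 y)) //.
move=> yk yk' /=; case: eqP => // _; case: ifP => // _; congr (- _).
apply: eq_bigr => z /and3P[_ _ /below_lt zy].
by apply: IHk; rewrite -ltnS; apply: leq_trans zy _.
Qed.

Lemma mobius_refl x : mobius x x = 1.
Proof.
rewrite /mobius; case E: #|T| => [|k] /=; last by rewrite eqxx.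
by have := fintype0 x E.
Qed.

Lemma mobius_lt x y : (x < y)%O ->
  mobius x y = - \sum_(z in J | (x <= z)%O && (z < y)%O) mobius x z.
Proof.
move=> xy; have le_below z : (below z <= #|T|)%N by apply: max_card.
rewrite {1}/mobius (@mobius_rec_stable _ #|T|.+1) ?leqW //=.
by rewrite (lt_eqF xy) xy.
Qed.

Lemma mobius_nle x y : ~~ (x <= y)%O -> mobius x y = 0.
Proof.
move=> nxy; rewrite /mobius; case: #|T| => //= k.
by case: eqP nxy => [->|_]; rewrite ?lexx // => /negbTE nxy; rewrite lt_neqAle nxy andbF.
Qed.

End Mobius.

(** [bnum a j] is $b_{2j}^a$; only even lower indices occur.  For [j = 0] the
    recursion has an empty sum and gives $b_0^a = -1$. *)
Fixpoint b_rec (a k j : nat) : rat :=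
  if k is k'.+1 then
    - 1 - \sum_(l < j) b_rec a k' l * 'C(a + 2 * j, a + 2 * l)%:R *
            ((2 * j - 2 * l)`!%:R / (2 ^ (j - l) * (j - l)`!)%:R)
  else 0.

Definition bnum (a j : nat) : rat := b_rec a j.+1 j.

Lemma b_rec_stable a k k' j : (j < k)%N -> (j < k')%N ->
  b_rec a k j = b_rec a k' j.
Proof.
elim: k k' j => [|k IHk] [|k'] j //= jk jk'; congr (_ - _).
apply: eq_bigr => l _; rewrite (IHk k') //; exact: leq_trans (ltn_ord l) _.
Qed.

Lemma bnum0 a : bnum a 0 = - 1.
Proof. by rewrite /bnum /= big_ord0 subr0. Qed.

Lemma bnumE a j : bnum a j =
  - 1 - \sum_(l < j) bnum a l * 'C(a + 2 * j, a + 2 * l)%:R *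
          ((2 * j - 2 * l)`!%:R / (2 ^ (j - l) * (j - l)`!)%:R).
Proof.
rewrite {1}/bnum /=; congr (_ - _); apply: eq_bigr => l _.
by rewrite (@b_rec_stable a j l.+1).
Qed.

(* Main.v *)
Require Import Defs.
From mathcomp Require Import all_boot all_order all_algebra.
From mathcomp Require Import zify.

(** Call a partition small when its blocks have at most two elements.  The
    Moebius function satisfies, besides its defining recursion in the second
    argument, the dual recursion in the first one, [mobius_lt_dual], because a
    one-sided inverse of the zeta matrix is two-sided.  For a small [p] with
    [S + j] blocks it reads
      mu(p, 1) = - 1 - sum of mu(z, 1) over the small z > p with |z| >= S,
    the - 1 being the contribution of the top element itself.  This has the
    form of the recursion that defines [bnum], so an induction on [j] reduces
    everything to counting, for each [l < j], the [z] with [S + l] blocks.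

    A small [z] above [p] keeps every two-element block of [p] and pairs up some
    of the singletons of [p], so it amounts to a matching on the set of those
    singletons; it has [i] blocks fewer than [p] exactly when the matching has
    [i] edges ([card_small_refinements]).  With [m] singletons there are
    C(m, 2i) (2i)! / (2^i i!) such matchings, by double counting of pairs
    (matching, edge of it) ([card_matchings]).  Counting elements gives
    [m = 2 (S + j) - n], which is [a + 2 j] for [a = 2 S - n], and with
    [i = j - l] and the symmetry of binomial coefficients these numbers are the
    coefficients in the definition of [bnum]. *)

Set Implicit Arguments.
Unset Strict Implicit.
Unset Printing Implicit Defensive.
Import Order.TTheory GRing.Theory Num.Theory.

(** * The dual recursion of the Moebius function *)

Section DualRecursion.
Variables (d : Order.disp_t) (T : finPOrderType d) (J : {set T}).
Local Open Scope ring_scope.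

(** The defining recursion, as the matrix identity mu * zeta = 1 over [J]. *)
Lemma sum_mobius x y : x \in J -> y \in J ->
  \sum_(z in J) mobius J x z * (z <= y)%O%:R = (x == y)%:R.
Proof.
move=> xJ yJ.
have -> : \sum_(z in J) mobius J x z * (z <= y)%O%:R
        = \sum_(z in J | (x <= z)%O && (z <= y)%O) mobius J x z.
  rewrite [RHS]big_mkcondr; apply: eq_bigr => z _.
  case: ifPn; first by case/andP=> _ ->; rewrite mulr1.
  by rewrite negb_and => /orP[/mobius_nle->|/negbTE->]; rewrite ?mul0r ?mulr0.
case: (boolP (x <= y)%O) => [|xy]; last first.
  rewrite big1 => [|z /and3P[_ xz zy]].
    by case: eqP xy => // ->; rewrite lexx.
  by case/negP: xy; apply: le_trans zy.
rewrite le_eqVlt => /predU1P[<-|xy].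
  rewrite eqxx (bigD1 x) /=; last by rewrite xJ lexx.
  rewrite mobius_refl big1 ?addr0 // => z /andP[/andP[_ xzx]].
  by rewrite -eq_le eq_sym in xzx; rewrite xzx.
rewrite (lt_eqF xy) (bigD1 y) /=; last by rewrite yJ (ltW xy) lexx.
rewrite mobius_lt //; apply/eqP; rewrite addrC subr_eq0; apply/eqP.
by apply: eq_bigl => z; rewrite -!andbA lt_neqAle [(z <= y)%O && _]andbC.
Qed.

(** For square matrices over a commutative ring, mu * zeta = 1 implies
    zeta * mu = 1, whose [(x, y)] entry is this recursion. *)
Lemma mobius_lt_dual x y : x \in J -> y \in J -> (x < y)%O ->
  mobius J x y = - \sum_(z in J | (x < z)%O && (z <= y)%O) mobius J z y.
Proof.
move=> xJ yJ xy.
pose M := \matrix_(i < #|J|, k < #|J|) mobius J (enum_val i) (enum_val k).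
pose Z := \matrix_(i < #|J|, k < #|J|) ((enum_val i <= enum_val k)%O%:R : int).
have MZ : M *m Z = 1%:M.
  apply/matrixP => i k; rewrite !mxE -(inj_eq enum_val_inj).
  rewrite -(sum_mobius (enum_valP i) (enum_valP k)) [RHS]big_enum_val.
  by apply: eq_bigr => l _; rewrite !mxE.
have := congr1 (fun A : 'M_#|J| => A (enum_rank_in xJ x) (enum_rank_in xJ y))
               (mulmx1C MZ).
rewrite !mxE -(inj_eq enum_val_inj) !enum_rankK_in //
  (lt_eqF xy) => ZM; apply/eqP; rewrite -addr_eq0 -[X in _ == X]/(false%:R) -ZM.
under [X in _ == X]eq_bigr do rewrite !mxE !enum_rankK_in //.
rewrite -(big_enum_val (fun z => (x <= z)%O%:R * mobius J z y)) /=.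
rewrite [X in _ == X](bigD1 x) //= lexx mul1r; apply/eqP; congr (_ + _).
rewrite [LHS]big_mkcondr [RHS]big_mkcondr /=; apply: eq_bigr => z _.
rewrite lt_neqAle eq_sym; case: eqVneq => //= _.
case: (boolP (x <= z)%O) => _; rewrite ?mul0r ?mul1r //=.
by case: ifPn => // /mobius_nle->.
Qed.
End DualRecursion.

(** * Counting matchings *)

Section Matchings.
Variable T : finType.
Implicit Types (U e : {set T}) (M : {set {set T}}).

Definition matchings U i : {set {set {set T}}} :=
  [set M | [&& trivIset M, cover M \subset U, [forall B in M, #|B| == 2] & #|M| == i]].

Lemma matchingsP U i M :
  reflect [/\ trivIset M, cover M \subset U, {in M, forall B : {set T}, #|B| = 2} & #|M| = i]
          (M \in matchings U i).
Proof.
rewrite inE; apply: (iffP and4P) => -[tM cM].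
  by move=> /forall_inP M2 /eqP Mi; split=> // B /M2/eqP.
by move=> M2 /eqP Mi; split=> //; apply/forall_inP => B /M2->.
Qed.

(** Removing the edge [e] from a matching leaves a matching that avoids [e]. *)
Lemma card_matchings_with_edge U i e : e \subset U -> #|e| = 2 ->
  #|[set M in matchings U i.+1 | e \in M]| = #|matchings (U :\: e) i|.
Proof.
move=> eU e2.
have e0 : e != set0 by rewrite -card_gt0 e2.
have edge_notin M : M \in matchings (U :\: e) i -> e \notin M.
  case/matchingsP=> _ cM _ _; apply: contra e0 => eM; apply/eqP/setP => x.
  rewrite inE; apply/negP => xe.
  have /(subsetP cM) : x \in cover M by apply/bigcupP; exists e.
  by rewrite inE xe.
rewrite -[RHS](@card_in_imset _ _ (fun M => e |: M)) => [|M N /edge_notin eM /edge_notin eN eMN].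
  2: by rewrite -[M](setU1K eM) eMN setU1K.
apply: eq_card => M; rewrite inE; apply/andP/imsetP => [[]|[N NU ->]].
  case/matchingsP=> tM cM M2 Mi eM; exists (M :\ e); last by rewrite setD1K.
  apply/matchingsP; split; first exact: trivIsetD.
  - by rewrite coverD1 // setSD.
  - by move=> B /setD1P[_ /M2].
  - by apply/eqP; rewrite -eqSS -Mi (cardsD1 e M) eM.
have eN := edge_notin N NU; case/matchingsP: NU => tN cN N2 Ni.
rewrite setU11; split=> //; apply/matchingsP; split.
- apply: trivIsetU => //.
    by apply/trivIsetP=> A B; rewrite !inE => /eqP-> /eqP->; rewrite eqxx.
  rewrite cover1; apply/pred0P => x; apply/negP => /andP[/= xe /(subsetP cN)].
  by rewrite inE xe.
- apply/bigcupsP => B /setU1P[->//|BN]; apply: subset_trans (subsetDl U e).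
  by apply: subset_trans cN; apply: (bigcup_max B).
- by move=> B /setU1P[->//|/N2].
- by rewrite cardsU1 eN Ni.
Qed.

(** Both sides count the pairs of a matching and one of its [i.+1] edges. *)
Lemma card_matchingsS U i :
  #|matchings U i.+1| * i.+1 = \sum_(e : {set T} | (e \subset U) && (#|e| == 2))
                                  #|matchings (U :\: e) i|.
Proof.
transitivity (\sum_(M in matchings U i.+1) \sum_(e in M) 1).
  rewrite -sum_nat_const; apply: eq_bigr => M /matchingsP[_ _ _ Mi].
  by rewrite sum1_card Mi.
rewrite (exchange_big_dep (fun e : {set T} => (e \subset U) && (#|e| == 2))) /=.
  apply: eq_bigr => e /andP[eU /eqP e2].
  by rewrite -card_matchings_with_edge // -sum1dep_card.
move=> M e /matchingsP[_ cM M2 _] eM; rewrite M2 // andbT.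
by apply: subset_trans cM; apply: (bigcup_max e).
Qed.

(** By induction on [i]: the first edge is one of 'C(#|U|, 2) pairs, the others
    form a matching on the remaining #|U| - 2 elements, and every matching
    arises once for each choice of its first edge. *)
Lemma card_matchings U i :
  #|matchings U i| * (2 ^ i * i`!) = #|U| ^_ (2 * i).
Proof.
elim: i U => [|i IHi] U.
  rewrite muln0 ffactn0 !muln1; apply/eqP/cards1P; exists set0.
  apply/setP => M; rewrite [RHS]inE; apply/matchingsP/eqP => [[_ _ _]|->].
    by move/eqP; rewrite cards_eq0 => /eqP.
  by rewrite /trivIset /cover !big_set0 !cards0 sub0set; split=> // B; rewrite inE.
have -> : 2 ^ i.+1 * i.+1`! = i.+1 * (2 * (2 ^ i * i`!)).
  by rewrite expnS factS; lia.
rewrite mulnA card_matchingsS mulnCA big_distrl /=.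
under eq_bigr => e /andP[eU /eqP e2] do rewrite IHi cardsD (setIidPr eU) e2.
rewrite sum_nat_const -(cardsE (fun e : {set T} => (e \subset U) && _)) cards_draws.
rewrite mulnA -[2]/(2`!) [_`! * _]mulnC bin_ffact mulnS.
by rewrite !ffactnS muln1 subn2 !mulnA.
Qed.

End Matchings.

(** * Refinements among partitions with blocks of size at most two *)

Section PartitionsIntoPairs.
Variable n : nat.
Implicit Types p q z : setpart n.

Definition small_blocks p := [forall B in blocks p, #|B| <= 2].

Definition singletons p : {set 'I_n} := [set x | [set x] \in blocks p].

Lemma block_eq p B C x : B \in blocks p -> C \in blocks p -> x \in B -> x \in C -> B = C.
Proof.
have /and3P[_ tp _] := blocksP p => Bp Cp xB xC.
by rewrite -(def_pblock tp Bp xB) (def_pblock tp Cp xC).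
Qed.

Lemma block_ex p x : exists2 B, B \in blocks p & x \in B.
Proof.
have := in_setT x; rewrite -(cover_partition (blocksP p)) => /bigcupP[B Bp xB].
by exists B.
Qed.

Lemma block_mem p B : B \in blocks p -> exists x, x \in B.
Proof. by move=> Bp; apply/set0Pn/(partition_neq0 (blocksP p)). Qed.

(** A block of size at most two that is a union of blocks of [p], without being
    one of them, must be the union of two singletons. *)
Lemma block_size2 p z B : small_blocks z -> refines p z ->
  B \in blocks z -> B \notin blocks p -> #|B| = 2 /\ B \subset singletons p.
Proof.
move=> /forall_inP sz /refinesP pz Bz Bp.
have sing x : x \in B -> x \in singletons p.
  move=> xB; have [A Ap xA] := block_ex p x; have [C Cz AC] := pz A Ap.
  have eCB : C = B by apply: (block_eq Cz Bz (subsetP AC x xA) xB).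
  rewrite eCB in AC; suff eA : A = [set x] by rewrite inE -eA.
  apply/eqP; rewrite eq_sym eqEcard sub1set xA cards1 /= -ltnS.
  apply: leq_trans (sz B Bz); apply: proper_card; rewrite properEneq AC andbT.
  by apply: contraNneq Bp => <-.
split; last by apply/subsetP.
have [x xB] := block_mem Bz; apply/eqP; rewrite eqn_leq sz //=.
rewrite (cardsD1 x) xB; rewrite add1n ltnS lt0n cards_eq0; apply: contraNneq Bp => B0.
have -> : B = [set x] by rewrite -(setD1K xB) B0 setU0.
by have := sing x xB; rewrite inE.
Qed.

(** A block [B] of size one or two contributes [2 - #|B|] singletons, and these
    numbers add up to [2 * #|blocks p| - n]. *)
Lemma card_singletons p : small_blocks p -> #|singletons p| = 2 * #|blocks p| - n.
Proof.
move=> /forall_inP sp.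
have -> : #|singletons p| = \sum_(B in blocks p) (2 - #|B|).
  rewrite (bigID (fun B : {set 'I_n} => #|B| == 1)) /= [X in _ + X]big1 ?addn0.
    rewrite (eq_bigr (fun=> 1)) => [|B /andP[_ /eqP->] //].
    rewrite sum1dep_card -(card_imset (mem (singletons p)) set1_inj); apply: eq_card => B.
    rewrite inE; apply/imsetP/andP => [[x + ->]|[Bp /cards1P[x Bx]]].
      by rewrite inE cards1.
    by exists x => //; rewrite inE -Bx.
  move=> B /andP[Bp B1]; apply/eqP; rewrite subn_eq0.
  have : 0 < #|B| by rewrite card_gt0 (partition_neq0 (blocksP p)).
  by case: #|B| B1 => [|[|]].
have nE : n = \sum_(B in blocks p) #|B|.
  by rewrite -(card_partition (blocksP p)) cardsT card_ord.
rewrite [X in _ - X]nE mulnC -sum_nat_const sumnB // => B /sp //.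
Qed.

(** The old blocks of [z] are determined by the new ones: they are the blocks of
    [p] that lie in no new block. *)
Lemma refines_inj p z w : refines p z -> refines p w ->
  blocks z :\: blocks p = blocks w :\: blocks p -> z = w.
Proof.
have half z' w' : refines p w' ->
    blocks z' :\: blocks p = blocks w' :\: blocks p -> blocks z' \subset blocks w'.
  move=> /refinesP pw E; apply/subsetP => B Bz; have [Bp|Bp] := boolP (B \in blocks p).
    have [x xB] := block_mem Bp; have [C Cw BC] := pw B Bp.
    have [Cp|Cp] := boolP (C \in blocks p).
      by rewrite (block_eq Bp Cp xB (subsetP BC x xB)).
    have : C \in blocks z' :\: blocks p by rewrite E inE Cp.
    by case/setDP=> Cz _; rewrite (block_eq Bz Cz xB (subsetP BC x xB)).
  have : B \in blocks z' :\: blocks p by rewrite inE Bp.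
  by rewrite E => /setDP[].
by move=> pz pw E; apply: val_inj; apply/eqP; rewrite eqEsubset !half.
Qed.

(** The partition consists of the edges of [M] together with the blocks of [p]
    disjoint from them; as the edges only touch singletons of [p], every other
    block of [p] is contained in an edge. *)
Lemma matching_refinement p i M : small_blocks p -> M \in matchings (singletons p) i ->
  exists z, [/\ small_blocks z, refines p z & blocks z :\: blocks p = M].
Proof.
move=> /forall_inP sp /matchingsP[tM cM M2 _].
have Mp B : B \in M -> B \notin blocks p.
  move=> BM; have /card_gt0P[x xB] : 0 < #|B| by rewrite M2.
  have : x \in singletons p by apply: (subsetP cM); apply/bigcupP; exists B.
  rewrite inE => xp; apply/negP => Bp; have := M2 B BM.
  by rewrite (block_eq Bp xp xB (set11 x)) cards1.
have covM B x : B \in blocks p -> x \in B -> x \in cover M -> B = [set x].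
  move=> Bp xB /(subsetP cM); rewrite inE => xp.
  exact: (block_eq Bp xp xB (set11 x)).
pose P := M :|: [set B in blocks p | [disjoint B & cover M]].
have PP : partition P [set: 'I_n].
  have /and3P[_ tp p0] := blocksP p; apply/and3P; split.
  - apply/eqP/setP => x; rewrite inE; apply/bigcupP.
    have [/bigcupP[B BM xB]|xM] := boolP (x \in cover M).
      by exists B => //; rewrite inE BM.
    have [B Bp xB] := block_ex p x; exists B => //; rewrite !inE Bp /=.
    apply/orP; right; apply/pred0P => y; apply/negP => /andP[/= yB yM].
    by move: xB; rewrite (covM B y) // inE => /eqP xy; rewrite xy yM in xM.
  - apply: trivIsetU => //.
      by apply: trivIsetS tp; apply/subsetP => B; rewrite inE => /andP[].
    apply/pred0P => y; apply/negP => /andP[/= yM /bigcupP[B]].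
    by rewrite inE => /andP[_ /disjointFr dB] /dB; rewrite yM.
  - rewrite !inE negb_or negb_and p0 andbT.
    by apply/negP => /M2; rewrite cards0.
exists (SetPart PP); split.
- by apply/forall_inP => B /setUP[/M2->//|]; rewrite inE => /andP[/sp].
- apply/refinesP => B Bp; have [dB|] := boolP [disjoint B & cover M].
    by exists B => //; rewrite !inE Bp dB orbT.
  case/pred0Pn=> x /andP[/= xB xM]; rewrite (covM B x) //.
  by case/bigcupP: xM => C CM xC; exists C; rewrite ?sub1set // inE CM.
- apply/setP => B; rewrite !inE /=; apply/andP/idP => [[/negbTE->] /orP[]//|BM].
  by rewrite BM Mp.
Qed.

Lemma sum_block_excess p : \sum_(B in blocks p) (#|B| - 1) = n - #|blocks p|.
Proof.
rewrite sumnB => [|B Bp]; last by rewrite card_gt0 (partition_neq0 (blocksP p)).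
by rewrite -(card_partition (blocksP p)) cardsT card_ord sum_nat_const muln1.
Qed.

Lemma card_blocks_le p : #|blocks p| <= n.
Proof.
rewrite -[X in _ <= X]card_ord -cardsT (card_partition (blocksP p)) -sum1_card.
by apply: leq_sum => B Bp; rewrite card_gt0 (partition_neq0 (blocksP p)).
Qed.

(** The excess [#|B| - 1] is 1 on a block of two elements and 0 on a singleton,
    so it sums to the number of two-element blocks.  Those of [z] are those of
    [p] and the new blocks; comparing the totals [n - #|blocks z|] and
    [n - #|blocks p|] gives the claim. *)
Lemma card_new_blocks p z : small_blocks z -> refines p z ->
  #|blocks z| + #|blocks z :\: blocks p| = #|blocks p|.
Proof.
move=> sz pz.
have e : n - #|blocks z| = (n - #|blocks p|) + #|blocks z :\: blocks p|.
  rewrite -!sum_block_excess (bigID [in blocks p]) /=; congr (_ + _).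
    rewrite [RHS](bigID [in blocks z]) /= [X in _ = _ + X]big1 ?addn0.
      by apply: eq_bigl => B; rewrite andbC.
    move=> B /andP[Bp Bz]; have /refinesP/(_ B Bp)[C Cz BC] := pz.
    apply/eqP; rewrite subn_eq0 -ltnS.
    apply: leq_trans (forall_inP sz C Cz); apply: proper_card.
    by rewrite properEneq BC andbT; apply: contraNneq Bz => ->.
  rewrite -sum1_card; apply: eq_big => [B|B /andP[Bz Bp]]; first by rewrite inE andbC.
  by have [-> _] := block_size2 sz pz Bz Bp.
have := card_blocks_le z; have := card_blocks_le p; lia.
Qed.

Lemma card_blocks_lt p z : small_blocks z -> (p < z)%O -> #|blocks z| < #|blocks p|.
Proof.
rewrite lt_neqAle setpart_leE => sz /andP[npz pz].
rewrite -(card_new_blocks sz pz) -[ltnLHS]addn0 ltn_add2l card_gt0.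
apply: contraNneq npz => E.
by rewrite (refines_inj (refines_refl p) pz) // E setDv.
Qed.

(** The bijection sends [z] to the set of its blocks that are not blocks of [p]. *)
Lemma card_small_refinements p i : small_blocks p ->
  #|[set z | [&& small_blocks z, refines p z & #|blocks z| + i == #|blocks p|]]|
  = #|matchings (singletons p) i|.
Proof.
move=> sp; rewrite -(@card_in_imset _ _ (fun z => blocks z :\: blocks p)).
  apply: eq_card => M; apply/imsetP/idP => [[z + ->]|MU].
    rewrite inE => /and3P[sz pz /eqP zi]; apply/matchingsP; split.
    - by apply: trivIsetD; have /and3P[] := blocksP z.
    - by apply/bigcupsP => B /setDP[Bz Bp]; have [] := block_size2 sz pz Bz Bp.
    - by move=> B /setDP[Bz Bp]; have [] := block_size2 sz pz Bz Bp.
    - by apply/eqP; rewrite -(eqn_add2l #|blocks z|) card_new_blocks // zi.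
  have [z [sz pz zM]] := matching_refinement sp MU; exists z => //.
  rewrite inE sz pz /= -(card_new_blocks sz pz) zM.
  by case/matchingsP: MU => _ _ _ ->.
by move=> z w; rewrite !inE => /and3P[_ pz _] /and3P[_ pw _]; apply: refines_inj.
Qed.
End PartitionsIntoPairs.

(** * The Moebius function at the top element *)

Section ValuesAtTop.
Local Open Scope ring_scope.

Lemma onepart_ge n (p : setpart n) : (p <= onepart n)%O.
Proof.
rewrite setpart_leE; apply/refinesP => B Bp; exists [set: 'I_n] => //.
have [x _] := block_mem Bp.
by rewrite onepartE ?inE //; apply: leq_ltn_trans (ltn_ord x).
Qed.

Lemma onepart_not_small n : (3 <= n)%N -> ~~ small_blocks (onepart n).
Proof.
move=> n3; apply/forall_inP => /(_ [set: 'I_n]).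
rewrite onepartE ?(ltnW (ltnW n3)) // set11 cardsT card_ord leqNgt n3.
by move/(_ isT).
Qed.

Lemma in_J3 n S (p : setpart n) : (3 <= n)%N -> p != onepart n ->
  (p \in J3 n S) = small_blocks p && (S <= #|blocks p|)%N.
Proof. by move=> n3 /negbTE p1; rewrite !inE p1 orbF. Qed.

(** The form in which the number of matchings enters the definition of [bnum]. *)
Lemma card_matchings_bin (R : numFieldType) (T : finType) (U : {set T}) i :
  #|matchings U i|%:R
  = 'C(#|U|, 2 * i)%:R * ((2 * i)`!%:R / (2 ^ i * i`!)%:R) :> R.
Proof.
rewrite mulrA -natrM bin_ffact -card_matchings natrM mulfK // pnatr_eq0 -lt0n.
by rewrite muln_gt0 expn_gt0 fact_gt0.
Qed.

(** Only the number of blocks of [p] matters, as it fixes the number of its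
    singletons; this is the form that supports the induction on [j]. *)
Lemma mobius_J3_onepart n S j (p : setpart n) :
  (3 <= n)%N -> (n <= 2 * S)%N -> small_blocks p -> #|blocks p| = (S + j)%N ->
  (mobius (J3 n S) p (onepart n))%:~R = bnum (2 * S - n) j :> rat.
Proof.
move=> n3 nS; elim/ltn_ind: j p => j IHj p sp pj.
have small_neq z : small_blocks z -> z != onepart n.
  by move=> sz; apply: contraTneq sz => ->; apply: onepart_not_small.
have p1 := small_neq p sp.
rewrite mobius_lt_dual; first last.
- by rewrite lt_neqAle p1 onepart_ge.
- by rewrite !inE eqxx orbT.
- by rewrite in_J3 // sp pj leq_addr.
(* The top element accounts for the term - 1 in the recursion of [bnum]. *)
rewrite (bigD1 (onepart n)) /=; last first.
  by rewrite !inE eqxx orbT lexx lt_neqAle p1 onepart_ge.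
rewrite mobius_refl opprD rmorphB /= bnumE rmorph_sum /=; congr (_ - _).
(* Each value is written as a one-term sum over its level [l = #|blocks z| - S],
   so that exchanging the sums groups the [z] by level. *)
rewrite (eq_bigr (fun z => \sum_(l < j | l == (#|blocks z| - S)%N :> nat)
                             bnum (2 * S - n) l)) => [|z]; last first.
  case/andP => /and3P[zJ pz _] z1; rewrite in_J3 // in zJ; case/andP: zJ => sz Sz.
  have zj : (#|blocks z| - S < j)%N by have := card_blocks_lt sz pz; lia.
  rewrite big_ord1_eq zj; apply: IHj => //; lia.
rewrite (exchange_big_dep predT) //=; apply: eq_bigr => l _.
rewrite sumr_const -[LHS]mulr_natr -mulrA; congr (_ * _).
have lj := ltn_ord l.
have -> : (2 * j - 2 * l = 2 * (j - l))%N by lia.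
have -> : 'C(2 * S - n + 2 * j, 2 * S - n + 2 * l)
        = 'C(#|singletons p|, 2 * (j - l)).
  rewrite card_singletons // pj -bin_sub; last by lia.
  by congr 'C(_, _); lia.
rewrite -card_matchings_bin -card_small_refinements //; congr _%:R.
apply: eq_card => z; rewrite [RHS]inE unfold_in.
have levelE a : (S <= a)%N && (l == (a - S)%N :> nat) = (a + (j - l) == S + j)%N by lia.
rewrite pj -levelE; apply/andP/and3P => [[/andP[/and3P[zJ pz _] z1] zl]|[sz pz /andP[Sz zl]]].
  rewrite in_J3 // in zJ; case/andP: zJ => sz Sz.
  by rewrite sz Sz (ltW pz : refines p z).
have z1 := small_neq z sz.
have zp : z != p.
  by apply: contraTneq zl => ->; rewrite pj addKn neq_ltn lj.
by rewrite z1 in_J3 // sz Sz onepart_ge lt_neqAle eq_sym zp setpart_leE pz.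
Qed.

End ValuesAtTop.

Theorem theorem6p3 (n S j : nat) (p : setpart n)
  (hn : (3 <= n)%N)
  (hS : (uphalf n <= S <= n - 1)%N)
  (hj : (j <= n - S)%N)
  (hp : p \in J3 n S)
  (hshape : pshape p = nseq (n - S - j) 2 ++ nseq (2 * S - n + 2 * j) 1) :
  ((mobius (J3 n S) p (onepart n))%:~R = bnum (2 * S - n) j :> rat)%R.
Proof.
have nS : (n <= 2 * S)%N by lia.
have pj : #|blocks p| = (S + j)%N.
  have := congr1 size hshape.
  rewrite size_sort size_map -cardE size_cat !size_nseq => ->; lia.
have p1 : p != onepart n.
  apply: contra_eq_neq pj => ->; rewrite onepartE ?cards1; lia.
apply: mobius_J3_onepart => //.
by rewrite in_J3 // in hp; case/andP: hp.
Qed.
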